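(* There exist absolute positive constants $C_1, C_2$ such that the following holds. Let $G \in \mathbb{R}^{n \times n}$ be a symmetric positive semidefinite matrix of rank $r \geq 1$, and let $V_r \in \mathbb{R}^{n \times r}$ be a matrix whose columns are orthonormal singular vectors of $G$ corresponding to its $r$ nonzero singular values. Let $\delta \in (0,1)$ and let $l, k$ be integers with $l \geq k \geq r$. Let $\widetilde{G}_k$ be the rank-$k$ Nyström approximation of $G$ obtained from $l$ columns of $G$ sampled uniformly at random with replacement. If $$l \geq r\,\mu^2(V_r)\,\max\bigl(C_1 \log(r),\, C_2 \log(3/\delta)\bigr),$$ where $\mu(V_r)$ is the coherence of $V_r$, then with probability at least $1-\delta$ over the sampling, $$\|G - \widetilde{G}_k\| = 0.$$
   Context: Coherence: for a matrix $V_r \in \mathbb{R}^{n \times r}$ with orthonormal columns, $\mu(V_r) = \sqrt{n}\,\max_{i,j} |(V_r)_{ij}|$, and $\mu^2(V_r)$ means $(\mu(V_r))^2$. Singular vectors: a symmetric positive semidefinite $G$ of rank $r$ is written $G = V\Sigma V^\top$ with $V$ orthogonal and $\Sigma = \mathrm{diag}(\sigma_1,\ldots,\sigma_n)$, $\sigma_1 \geq \cdots \geq \sigma_n \geq 0$; $V_r$ consists of the first $r$ columns of $V$, so $V_r^\top V_r = I$. Nyström approximation: let $i_1,\ldots,i_l \in \{1,\ldots,n\}$ be the sampled column indices (independent and uniform). Let $C \in \mathbb{R}^{n \times l}$ be the matrix whose $t$-th column is the $i_t$-th column of $G$, and let $W \in \mathbb{R}^{l \times l}$ be the matrix with entries $W_{st}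 = G_{i_s i_t}$. The rank-$k$ Nyström approximation is $\widetilde{G}_k = C\, W_k^{+}\, C^\top$. Here $W_k$ is the best rank-$k$ approximation of the symmetric positive semidefinite matrix $W$, i.e. the truncation of its spectral decomposition to its $k$ largest eigenvalues (so $W_k = W$ if $k \geq \mathrm{rank}(W)$), and $^{+}$ denotes the Moore–Penrose pseudo-inverse. The norm $\|\cdot\|$ may be taken to be the spectral or the Frobenius norm; the conclusion says that $\widetilde{G}_k = G$ exactly. *)

(* Defs.v *)
From HB Require Import structures.
From mathcomp Require Import all_boot all_order all_algebra.
From mathcomp Require Import all_classical all_reals all_analysis.

Set Implicit Arguments.
Unset Strict Implicit.
Unset Printing Implicit Defensive.

Import Order.TTheory GRing.Theory Num.Theory.
Local Open Scope ring_scope.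

Definition is_psd (R : realType) (n : nat) (A : 'M[R]_n) : Prop :=
  A^T = A /\ forall x : 'cV[R]_n, 0 <= (x^T *m A *m x) 0 0.

(* A = U diag(s) U^T with U orthogonal and s_0 >= s_1 >= ... >= 0; for positive
   semidefinite A this is at once a spectral and a singular value decomposition. *)
Definition spectral_decomposition (R : realType) (n : nat)
    (A U : 'M[R]_n) (s : 'rV[R]_n) : Prop :=
  [/\ U^T *m U = 1%:M,
      A = U *m diag_mx s *m U^T,
      forall i : 'I_n, 0 <= s 0 i
    & forall i j : 'I_n, (i <= j)%N -> s 0 j <= s 0 i].

(* The columns of V are distinct columns of some orthogonal U as above, all
   belonging to nonzero singular values.  When r = \rank A they exhaust these
   values; V is then the first r columns of U, in any order. *)
Definition nonzero_singular_vectors (R : realType) (n r : nat)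
    (A : 'M[R]_n) (V : 'M[R]_(n, r)) : Prop :=
  exists (U : 'M[R]_n) (s : 'rV[R]_n) (f : 'I_r -> 'I_n),
    [/\ spectral_decomposition A U s, injective f,
        forall j : 'I_r, s 0 (f j) != 0 & V = colsub f U].

Definition coherence (R : realType) (n r : nat) (V : 'M[R]_(n, r)) : R :=
  Num.sqrt n%:R * \big[Num.max/0]_(i < n) \big[Num.max/0]_(j < r) `|V i j|.

(* A relation rather than a function: the truncation depends on the chosen
   decomposition when the k-th and (k+1)-st eigenvalues coincide and are
   nonzero.  If k >= \rank A, then B = A. *)
Definition spectral_truncation (R : realType) (n : nat)
    (A : 'M[R]_n) (k : nat) (B : 'M[R]_n) : Prop :=
  exists (U : 'M[R]_n) (s : 'rV[R]_n),
    spectral_decomposition A U s /\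
    B = U *m diag_mx (\row_(i < n) (if (i < k)%N then s 0 i else 0)) *m U^T.

(* The four Penrose equations. *)
Definition is_moore_penrose (R : realType) (m n : nat)
    (A : 'M[R]_(m, n)) (X : 'M[R]_(n, m)) : Prop :=
  [/\ A *m X *m A = A, X *m A *m X = X,
      (A *m X)^T = A *m X & (X *m A)^T = X *m A].

(* The sample may contain repeated indices, so idx need not be injective. *)
Definition is_nystrom (R : realType) (n l : nat) (G : 'M[R]_n) (k : nat)
    (idx : {ffun 'I_l -> 'I_n}) (Gk : 'M[R]_n) : Prop :=
  let C : 'M[R]_(n, l) := colsub idx G in
  let W : 'M[R]_l := mxsub idx idx G in
  exists Wk Wk_pinv : 'M[R]_l,
    [/\ spectral_truncation W k Wk, is_moore_penrose Wk Wk_pinv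
      & Gk = C *m Wk_pinv *m C^T].

Definition frobenius_norm (R : realType) (m n : nat) (A : 'M[R]_(m, n)) : R :=
  Num.sqrt (\sum_(i < m) \sum_(j < n) A i j ^+ 2).

(* On column vectors the Frobenius norm is the Euclidean norm. *)
Definition spectral_norm (R : realType) (m n : nat) (A : 'M[R]_(m, n)) : R :=
  sup [set frobenius_norm (A *m x) |
       x in [set x : 'cV[R]_n | frobenius_norm x <= 1]]%classic.

(* On T = {ffun 'I_l -> 'I_n} this is the joint law of l independent uniform
   draws from 'I_n, i.e. uniform sampling with replacement. *)
Definition uniform_Pr (R : realType) (T : finType) (E : {set T}) : R :=
  #|E|%:R / #|T|%:R.

(* Main.v *)
(* The rows v_i of V_r satisfy sum_i v_i v_i^T = I and |v_i|^2 <= m / n, where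
   m = r mu^2(V_r).  If the rows sampled so far span a space of dimension d < r
   and P is the orthogonal projector onto its complement, then
   r - d = tr P = sum_i v_i P v_i^T, where the terms with v_i in the span vanish
   and the others are at most m / n; hence at least (r - d) n / m rows lie
   outside the span.  So each draw shrinks the expected rank deficit by a factor
   1 - 1/m, and after l draws P(deficit > 0) <= E(deficit) <= r exp(- l / m),
   which is at most delta / 3 with C1 = C2 = 2; no matrix concentration
   inequality is needed.  If the sampled rows V_S have rank r, then W = V_S D V_S^T
   has rank at most k, so W_k = W, and cancelling the left inverse of V_S in
   W W^+ W = W gives D V_S^T W^+ V_S D = D, i.e. C W^+ C^T = V D V^T = G. *)
Require Import Defs.
From HB Require Import structures.
From mathcomp Require Import all_boot all_order all_algebra.
From mathcomp Require Import all_classical all_reals all_analysis.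
From mathcomp Require Import ring lra.

Set Implicit Arguments.
Unset Strict Implicit.
Unset Printing Implicit Defensive.

Import Order.TTheory GRing.Theory Num.Theory.
Local Open Scope ring_scope.

(** * Gram matrices and orthogonal projectors *)

Lemma mulmx_tr_eq0 (R : realFieldType) (m n : nat) (A : 'M[R]_(m, n)) :
  A *m A^T = 0 -> A = 0.
Proof.
move=> AAt0; apply/matrixP => i j; apply/eqP; rewrite mxE -sqrf_eq0.
have /eqP := congr1 (fun B : 'M[R]_m => B i i) AAt0.
rewrite !mxE psumr_eq0 => [/allP/(_ j)|k _]; last by rewrite mxE -expr2 sqr_ge0.
by rewrite mem_index_enum mxE -expr2; apply.
Qed.

(** If [K] kills [A *m A^T] on the left, then [K *m A] times its own transpose vanishes, so
    [K *m A = 0]. *)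
Lemma row_free_gram_unit (R : realFieldType) (m n : nat) (A : 'M[R]_(m, n)) :
  row_free A -> A *m A^T \in unitmx.
Proof.
move=> freeA; rewrite -row_free_unit -kermx_eq0; apply/eqP.
set K := kermx _; apply: (row_free_inj freeA); rewrite mul0mx.
by apply: mulmx_tr_eq0; rewrite trmx_mul mulmxA -(mulmxA K) mulmx_ker mul0mx.
Qed.

Lemma orthogonal_projector (R : realFieldType) (m n : nat) (A : 'M[R]_(m, n)) :
  exists P : 'M[R]_n,
    [/\ P^T = P, P *m P = P, A *m P = 0 & \tr P = (n - \rank A)%:R].
Proof.
have [K freeK KAt] :
    exists2 K : 'M[R]_(n - \rank A, n), row_free K & K *m A^T = 0.
  rewrite -mxrank_tr -mxrank_ker; exists (row_base (kermx A^T)).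
    exact: row_base_free.
  by apply/sub_kermxP; rewrite eq_row_base.
have unitK := row_free_gram_unit freeK.
have AKt : A *m K^T = 0 by apply: trmx_inj; rewrite trmx_mul trmxK trmx0.
(* The rows of [K] form a basis of the orthogonal complement of the row space of [A]; this is the
   projector onto their span, and cyclicity of the trace counts them. *)
exists (K^T *m invmx (K *m K^T) *m K); split.
- by rewrite !trmx_mul trmx_inv trmx_mul !trmxK mulmxA.
- rewrite -!mulmxA (mulmxA K) (mulmxA (invmx _) (K *m K^T)).
  by rewrite mulVmx // mul1mx.
- by rewrite !mulmxA AKt !mul0mx.
- by rewrite -mulmxA mxtrace_mulC -mulmxA mulVmx // mxtrace1.
Qed.

Lemma rank_deficit_le (R : realFieldType) (m n r : nat) (V : 'M[R]_(n, r))
    (A : 'M[R]_(m, r)) (c : R) :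
  V^T *m V = 1%:M -> (forall i, (V *m V^T) i i <= c) ->
  (r - \rank A)%:R <= c * #|[set i | ~~ (row i V <= A)%MS]|%:R.
Proof.
move=> VtV rowV; have [P [Pt PP AP <-]] := orthogonal_projector A.
have -> : \tr P = \tr (V *m P *m V^T).
  by rewrite -mulmxA mxtrace_mulC -mulmxA VtV mulmx1.
rewrite mulr_natr -sumr_const [leRHS]big_mkcond /=.
apply: ler_sum => i _; rewrite inE; case: ifP => [_|/negbFE/submxP[D rowE]].
  apply: le_trans (rowV i); rewrite -subr_ge0.
  (* [1 - P] is again an orthogonal projector, so the difference is the squared norm of row [i] of
     [V *m (1 - P)]. *)
  have -> : (V *m V^T) i i - (V *m P *m V^T) i i
          = (V *m (1%:M - P) *m (V *m (1%:M - P))^T) i i.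
    have Qt : (1%:M - P)^T = 1%:M - P by rewrite raddfB /= trmx1 Pt.
    have QQ : (1%:M - P) *m (1%:M - P) = 1%:M - P.
      by rewrite mulmxBl !mulmxBr !mul1mx mulmx1 PP subrr subr0.
    rewrite trmx_mul Qt mulmxA -(mulmxA V _ (1%:M - P)) QQ.
    by rewrite mulmxBr mulmx1 mulmxBl [RHS]mxE [X in _ = _ + X]mxE.
  by rewrite mxE sumr_ge0 // => j _; rewrite [_^T _ _]mxE -expr2 sqr_ge0.
have -> : (V *m P *m V^T) i i = (row i V *m P *m (row i V)^T) 0 0.
  rewrite -!row_mul tr_row !mxE; apply: eq_bigr => j _.
  by rewrite !mxE.
by rewrite rowE -(mulmxA D) AP mulmx0 mul0mx mxE.
Qed.

(** * Decay of the total rank deficit, one draw at a time *)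

Definition ffun_cons (T : finType) (l : nat) (i : T) (g : {ffun 'I_l -> T}) :
    {ffun 'I_l.+1 -> T} :=
  [ffun j => oapp g i (unlift ord0 j)].

(** Serves to average over one draw while the other [l] are held fixed. *)
Lemma sum_ffun_recl (R : nmodType) (T : finType) (l : nat)
    (F : {ffun 'I_l.+1 -> T} -> R) :
  \sum_f F f = \sum_(g : {ffun 'I_l -> T}) \sum_i F (ffun_cons i g).
Proof.
rewrite pair_big /=.
apply: (reindex (fun p : {ffun 'I_l -> T} * T => ffun_cons p.2 p.1)).
exists (fun f : {ffun 'I_l.+1 -> T} =>
  ([ffun j : 'I_l => f (lift ord0 j)], f ord0)) => [[g i]|f] _ /=.
  congr (_, _); last by rewrite ffunE unlift_none.
  by apply/ffunP => j; rewrite !ffunE liftK.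
by apply/ffunP => j; rewrite !ffunE; case: unliftP => [k|] -> //=; rewrite ffunE.
Qed.

Lemma rowsub_cons (R : fieldType) (n r l : nat) (V : 'M[R]_(n, r))
    (i : 'I_n) (g : {ffun 'I_l -> 'I_n}) :
  (row i V + rowsub g V <= rowsub (ffun_cons i g) V)%MS.
Proof.
rewrite addsmx_sub; apply/andP; split.
  have -> : row i V = row ord0 (rowsub (ffun_cons i g) V).
    by rewrite row_rowsub ffunE unlift_none.
  exact: row_sub.
apply/row_subP => j; rewrite row_rowsub.
have -> : row (g j) V = row (lift ord0 j) (rowsub (ffun_cons i g) V).
  by rewrite row_rowsub ffunE liftK.
exact: row_sub.
Qed.

(** Division by [n ^ l] turns the sum into the expected deficit, with factor [1 - 1 / (n c)] per
    draw. The bound on [c^-1] keeps that factor nonnegative, as the induction requires. *)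
Lemma sum_rank_deficit_le (R : realFieldType) (n r l : nat) (V : 'M[R]_(n, r))
    (c : R) :
  V^T *m V = 1%:M -> (forall i, (V *m V^T) i i <= c) -> 0 < c ->
  c^-1 <= n%:R ->
  \sum_(f : {ffun 'I_l -> 'I_n}) (r - \rank (rowsub f V))%:R
    <= r%:R * (n%:R - c^-1) ^+ l :> R.
Proof.
move=> VtV rowV c_gt0 c_le; elim: l => [|l IHl].
  apply: (@le_trans _ _ (\sum_(f : {ffun 'I_0 -> 'I_n}) r%:R)).
    by apply: ler_sum => f _; rewrite ler_nat leq_subr.
  by rewrite sumr_const card_ffun !card_ord expn0 expr0 mulr1.
rewrite sum_ffun_recl exprS mulrCA.
apply: le_trans (ler_wpM2l _ IHl); last by rewrite subr_ge0.
rewrite mulr_sumr; apply: ler_sum => g _.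
set d := \rank (rowsub g V); pose S := [set i | ~~ (row i V <= rowsub g V)%MS].
(* A row outside the span raises the rank by at least one. Subtraction of naturals truncates, so the
   strict drop also uses that the new rank is at most [r]. *)
have step i : (r - \rank (rowsub (ffun_cons i g) V))%:R
    <= (r - d)%:R - (i \in S)%:R :> R.
  have le_cons := mxrankS (rowsub_cons V i g).
  have d_le : (\rank (rowsub g V) <= \rank (row i V + rowsub g V)%MS)%N.
    by rewrite mxrankS ?addsmxSr.
  have r_ge := rank_leq_col (rowsub (ffun_cons i g) V).
  rewrite lerBrDr -natrD ler_nat inE; case: (boolP (_ <= _)%MS) => /= [_|iS].
    by rewrite addn0 leq_sub2l // (leq_trans d_le).
  have d_lt : (d < \rank (row i V + rowsub g V)%MS)%N.
    by apply: rank_ltmx; rewrite ltmxE addsmxSr addsmx_sub submx_refl andbT.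
  have := leq_trans d_lt le_cons; rewrite addn1.
  by move=> lt_d; rewrite ltn_sub2l // (leq_trans lt_d).
apply: le_trans (ler_sum _ (fun i _ => step i)) _.
(* Summed over [i], the claim reduces to [c^-1 * (r - d) <= #|S|]. *)
rewrite sumrB sumr_const card_ord -[_ *+ n]mulr_natl mulrBl lerD2l lerN2.
rewrite -natr_sum -big_mkcond sum1_card ler_pdivrMl //.
exact: rank_deficit_le.
Qed.

(** * Rank, spectral truncation and exact recovery *)

Lemma mxrank_mxsub_le (F : fieldType) (m n p q : nat) (f : 'I_p -> 'I_m)
    (g : 'I_q -> 'I_n) (A : 'M[F]_(m, n)) :
  (\rank (mxsub f g A) <= \rank A)%N.
Proof.
have -> : mxsub f g A = rowsub f (colsub g A) by apply/matrixP => i j; rewrite !mxE.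
apply: leq_trans (mxrankS (rowsub_sub _ _)) _.
rewrite -mxrank_tr trmx_mxsub -(mxrank_tr A).
exact: mxrankS (rowsub_sub _ _).
Qed.

(** The principal submatrix on the support is diagonal with nonzero entries, hence invertible. *)
Lemma card_support_le_rank_diag (F : fieldType) (n : nat) (s : 'rV[F]_n) :
  (#|[set i | (s 0 i != 0)%R]| <= \rank (diag_mx s))%N.
Proof.
set A := [set i | _]; pose g : 'I_#|A| -> 'I_n := enum_val.
have gE : mxsub g g (diag_mx s) = diag_mx (colsub g s).
  by apply/matrixP => i j; rewrite !mxE (inj_eq enum_val_inj).
rewrite -[leqLHS](_ : \rank (mxsub g g (diag_mx s)) = #|A|) ?mxrank_mxsub_le //.
rewrite gE mxrank_unit // unitmxE det_diag unitfE; apply/prodf_neq0 => i _.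
by have := enum_valP i; rewrite inE mxE.
Qed.

Lemma spectral_rank (R : realType) (n : nat) (A U : 'M[R]_n) (s : 'rV[R]_n) :
  spectral_decomposition A U s -> \rank A = \rank (diag_mx s).
Proof.
case=> /mulmx1_unit[Ut_unit U_unit] -> _ _.
by rewrite mxrankMfree ?row_free_unit // eqmxMfull // row_full_unit.
Qed.

Lemma spectral_truncation_id (R : realType) (n k : nat) (A B : 'M[R]_n) :
  (\rank A <= k)%N -> spectral_truncation A k B -> B = A.
Proof.
move=> rkA [U [s [dec ->]]]; have rkE := spectral_rank dec.
case: dec => _ AE s_ge0 s_sorted; rewrite [RHS]AE; congr (_ *m diag_mx _ *m _).
apply/rowP => i; rewrite mxE; case: ltnP => // le_k_i; apply/esym/eqP.
apply: contraTT (leq_trans rkA le_k_i) => si_neq0; rewrite -ltnNge rkE.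
apply: leq_trans (card_support_le_rank_diag s).
(* By sortedness a nonzero [s 0 i] makes all values at [0, ..., i] nonzero; these [i + 1] indices
   are the image of ['I_i.+1], so the rank exceeds [i >= k]. *)
have widen_inj : injective (widen_ord (ltn_ord i)).
  by move=> a b /(congr1 val) /= /val_inj.
rewrite -[leqLHS]card_ord -(card_imset _ widen_inj).
apply: subset_leq_card; apply/fintype.subsetP => _ /imsetP[j _ ->].
have si_gt0 : 0 < s 0 i by rewrite lt_def si_neq0 s_ge0.
rewrite inE; apply/lt0r_neq0/(lt_le_trans si_gt0)/s_sorted.
by rewrite -ltnS; exact: (ltn_ord j).
Qed.

Lemma nonzero_singular_vectors_factor (R : realType) (n r : nat) (G : 'M[R]_n)
    (V : 'M[R]_(n, r)) :
  \rank G = r -> nonzero_singular_vectors G V ->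
  V^T *m V = 1%:M /\ exists d : 'rV[R]_r, G = V *m diag_mx d *m V^T.
Proof.
move=> rkG [U [s [f [dec f_inj sf_neq0 ->]]]]; have rkE := spectral_rank dec.
case: dec => UtU GE _ _; split.
  rewrite trmx_mxsub mul_rowsub_mx mulmx_colsub UtU.
  by apply/matrixP => i j; rewrite !mxE (inj_eq f_inj).
(* The image of [f] has [r] elements inside a support of size at most [\rank G = r], so the two sets
   agree and the columns left out carry zero weight. *)
have supp : [set f j | j : 'I_r] = [set i | (s 0 i != 0)%R].
  apply/eqP; rewrite eqEcard card_imset // card_ord -[X in (_ <= X)%N]rkG rkE.
  rewrite card_support_le_rank_diag andbT.
  by apply/fintype.subsetP => _ /imsetP[j _ ->]; rewrite inE.
exists (colsub f s); rewrite GE; apply/matrixP => i j.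
rewrite !mul_mx_diag !mxE (bigID (mem [set f j | j : 'I_r])) /= addrC big1 ?add0r.
  rewrite big_imset /=; last by move=> ? ? _ _; apply: f_inj.
  by apply: eq_big => [k|k _]; rewrite ?inE // !mxE.
by move=> k; rewrite supp inE negbK => /eqP sk0; rewrite !mxE sk0 mulr0 mul0r.
Qed.

Lemma nystrom_exact (R : realType) (n r l k : nat) (G : 'M[R]_n)
    (V : 'M[R]_(n, r)) (d : 'rV[R]_r) (idx : {ffun 'I_l -> 'I_n})
    (Gk : 'M[R]_n) :
  G = V *m diag_mx d *m V^T -> \rank (rowsub idx V) = r -> (\rank G <= k)%N ->
  is_nystrom G k idx Gk -> Gk = G.
Proof.
move=> GE rkVS rkG [Wk [X [trW [WXW _ _ _] ->]]].
have WkE : Wk = mxsub idx idx G.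
  by apply: spectral_truncation_id trW; apply: leq_trans (mxrank_mxsub_le _ _ _) rkG.
have /row_fullP[L LVS] : row_full (rowsub idx V) by apply/eqP.
set VS := rowsub idx V in LVS.
have VStLt : VS^T *m L^T = 1%:M by rewrite -trmx_mul LVS trmx1.
have CE : colsub idx G = V *m diag_mx d *m VS^T.
  by rewrite GE trmx_mxsub mulmx_colsub.
have WE : mxsub idx idx G = VS *m diag_mx d *m VS^T.
  rewrite /VS !mul_rowsub_mx -CE.
  by apply/matrixP => i j; rewrite !mxE.
rewrite WkE WE in WXW.
(* [L] on the left and [L^T] on the right strip the outer factors [VS] and [VS^T] from
   [W X W = W]. *)
have core : diag_mx d *m VS^T *m X *m VS *m diag_mx d = diag_mx d.
  have := congr1 (fun B => L *m B *m L^T) WXW.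
  rewrite /= !mulmxA LVS mul1mx -!(mulmxA _ VS^T) VStLt !mulmx1.
  by rewrite !mulmxA.
rewrite CE !trmx_mul trmxK tr_diag_mx [RHS]GE -[in RHS]core.
by rewrite !mulmxA.
Qed.

(** * Norms, coherence and the numerical bound *)

Lemma frobenius_norm0 (R : realType) (m n : nat) :
  frobenius_norm (0 : 'M[R]_(m, n)) = 0.
Proof.
rewrite /frobenius_norm big1 ?sqrtr0 // => i _.
by rewrite big1 // => j _; rewrite mxE expr0n.
Qed.

Lemma spectral_norm0 (R : realType) (m n : nat) :
  spectral_norm (0 : 'M[R]_(m, n)) = 0.
Proof.
rewrite /spectral_norm -[RHS]sup1; congr sup; apply/seteqP; split=> x /=.
  by case=> y _ <-; rewrite mul0mx frobenius_norm0.
by move=> ->; exists 0; rewrite ?mul0mx frobenius_norm0.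
Qed.

Lemma row_norm_le_coherence (R : realType) (n r : nat) (V : 'M[R]_(n, r)) (i : 'I_n) :
  (V *m V^T) i i <= r%:R * coherence V ^+ 2 / n%:R.
Proof.
have n_gt0 : 0 < n%:R :> R by rewrite ltr0n (leq_ltn_trans _ (ltn_ord i)).
(* The factor [n] from the squared coherence cancels the division, leaving [r] times the squared
   largest entry. *)
rewrite /coherence exprMn sqr_sqrtr ?ler0n // mulrCA mulrC mulKf ?gt_eqF //.
set b := \big[_/_]_(_ < n) _.
have -> : r%:R * b ^+ 2 = \sum_(j < r) b ^+ 2.
  by rewrite sumr_const card_ord mulr_natl.
rewrite mxE; apply: ler_sum => j _; rewrite mxE -expr2 -real_normK ?num_real //.
have le_b : `|V i j| <= b.
  apply: le_trans (le_bigmax _ (fun i => \big[Num.max/0]_(j < r) `|V i j|) i).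
  exact: (le_bigmax _ (fun j => `|V i j|)).
by rewrite lerXn2r ?nnegrE // (le_trans _ le_b).
Qed.

Lemma deficit_bound_le (R : realType) (n r l : nat) (c delta : R) :
  (0 < n)%N -> (0 < r)%N -> 0 < c -> c^-1 <= n%:R -> 0 < delta ->
  n%:R * c * Num.max (2 * ln r%:R) (2 * ln (3 / delta)) <= l%:R ->
  r%:R * (n%:R - c^-1) ^+ l <= delta * n%:R ^+ l.
Proof.
rewrite -(ltr0n R) -(ltr0n R r) => n_gt0 r_gt0 c_gt0 c_le d_gt0.
set t := Num.max _ _ => le_l.
have d3_gt0 : 0 < 3 / delta by rewrite divr_gt0.
have nc_gt0 : 0 < n%:R * c by rewrite mulr_gt0.
(* The maximum of [2 * ln r] and [2 * ln (3 / delta)] is at least their mean, [ln (3 r / delta)];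
   this fixes the constants at 2. *)
have le_t : ln (r%:R * (3 / delta)) <= l%:R / (n%:R * c).
  rewrite lnM ?posrE // ler_pdivlMr // mulrC; apply: le_trans le_l.
  rewrite ler_pM2l //.
  have : 2 * ln r%:R <= t by rewrite le_max lexx.
  have : 2 * ln (3 / delta) <= t by rewrite le_max lexx orbT.
  by lra.
have -> : n%:R - c^-1 = n%:R * (1 - (n%:R * c)^-1).
  by field; rewrite !gt_eqF.
rewrite exprMn mulrCA mulrC ler_pM2r ?exprn_gt0 //.
(* From [1 + x <= expR x] at [x = - 1 / (n c)], raised to the power [l]; the base is nonnegative
   since [n c >= 1]. *)
apply: (@le_trans _ _ (r%:R * expR (- (l%:R / (n%:R * c))))).
  rewrite ler_pM2l // -mulrN expRM_natl lerXn2r ?nnegrE ?expR_ge0 //.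
    by rewrite subr_ge0 invf_le1 // -ler_pdivrMr // div1r.
  exact: expR_ge1Dx.
rewrite expRN ler_pdivrMr ?expR_gt0 //.
apply: (@le_trans _ _ (delta * (r%:R * (3 / delta)))); last first.
  have r3_gt0 : 0 < r%:R * (3 / delta) by rewrite mulr_gt0.
  by rewrite ler_pM2l // -[leLHS]lnK ?ler_expR // posrE.
have -> : delta * (r%:R * (3 / delta)) = r%:R * 3 by field; rewrite gt_eqF.
by lra.
Qed.

(** * Probability of exact recovery under uniform sampling *)

Theorem theorem3 (R : realType) :
  exists C1 C2 : R, 0 < C1 /\ 0 < C2 /\
    forall (n r l k : nat) (G : 'M[R]_n) (Vr : 'M[R]_(n, r)) (delta : R)
           (Gk : {ffun 'I_l -> 'I_n} -> 'M[R]_n),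
      is_psd G -> \rank G = r -> (1 <= r)%N ->
      nonzero_singular_vectors G Vr ->
      0 < delta -> delta < 1 ->
      (r <= k)%N -> (k <= l)%N ->
      (forall idx : {ffun 'I_l -> 'I_n}, is_nystrom G k idx (Gk idx)) ->
      r%:R * coherence Vr ^+ 2 *
        Num.max (C1 * ln r%:R) (C2 * ln (3 / delta)) <= l%:R ->
      1 - delta <=
        uniform_Pr R [set idx : {ffun 'I_l -> 'I_n} |
          (spectral_norm (G - Gk idx) == 0) &&
          (frobenius_norm (G - Gk idx) == 0)].
Proof.
exists 2, 2; split; [by rewrite ltr0n | split; first by rewrite ltr0n].
move=> n r l k G V delta Gk _ rkG r_gt0 singV d_gt0 _ le_rk _ nysG le_l.
have [VtV [d GE]] := nonzero_singular_vectors_factor rkG singV.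
have n_gt0 : (0 < n)%N.
  by rewrite (leq_trans r_gt0) // -rkG rank_leq_row.
have nR_gt0 : 0 < n%:R :> R by rewrite ltr0n.
pose c := r%:R * coherence V ^+ 2 / n%:R.
have c_ge0 : 0 <= c by rewrite divr_ge0 // mulr_ge0 // sqr_ge0.
have rowV i : (V *m V^T) i i <= c by exact: row_norm_le_coherence.
(* The empty sample has deficit [r], and at most [n] rows lie outside its span, so
   [1 <= r <= c * n]. *)
have cn_ge1 : 1 <= c * n%:R.
  have := rank_deficit_le (0 : 'M[R]_(0, r)) VtV rowV.
  rewrite mxrank0 subn0 => r_le; apply: (@le_trans _ _ r%:R); rewrite ?ler1n //.
  apply: le_trans r_le _; rewrite ler_wpM2l // ler_nat.
  by rewrite -[leqRHS](card_ord n) max_card.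
have c_gt0 : 0 < c.
  by rewrite lt_def c_ge0 andbT; apply: contraTneq cn_ge1 => ->; rewrite mul0r ler10.
have cV_le : c^-1 <= n%:R by rewrite -[c^-1]mul1r ler_pdivrMr // mulrC.
pose T := {ffun 'I_l -> 'I_n}.
pose full := [set idx : T | \rank (rowsub idx V) == r].
have exact_full : full \subset [set idx : T |
    (spectral_norm (G - Gk idx) == 0) && (frobenius_norm (G - Gk idx) == 0)].
  apply/fintype.subsetP => idx; rewrite !inE => /eqP rk_idx.
  rewrite (nystrom_exact GE rk_idx _ (nysG idx)) ?rkG // subrr.
  by rewrite spectral_norm0 frobenius_norm0 eqxx.
have cardT : #|T|%:R = n%:R ^+ l :> R.
  by rewrite card_ffun !card_ord natrX.
have nl_gt0 : 0 < n%:R ^+ l :> R by rewrite exprn_gt0.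
have bad_le : #|~: full|%:R <= delta * n%:R ^+ l.
  rewrite (le_trans _ (deficit_bound_le n_gt0 r_gt0 c_gt0 cV_le d_gt0 _)) //.
    (* Markov's inequality in counting form: each sample of deficient rank adds at least 1 to the
       total deficit. *)
    apply: le_trans (sum_rank_deficit_le l VtV rowV c_gt0 cV_le).
    rewrite -sumr_const big_mkcond /=; apply: ler_sum => idx _.
    rewrite !inE; case: eqP => [_|/eqP rk_idx] /=; first exact: ler0n.
    by rewrite ler1n subn_gt0 ltn_neqAle rk_idx rank_leq_col.
  by rewrite (_ : n%:R * c = r%:R * coherence V ^+ 2) // mulrC divfK ?gt_eqF.
rewrite /uniform_Pr cardT ler_pdivlMr // mulrBl mul1r.
apply: (@le_trans _ _ #|full|%:R); last by rewrite ler_nat subset_leq_card.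
by rewrite lerBlDr -[leLHS]cardT -(cardsC full) natrD lerD2l.
Qed.
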